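(* For every integer $k\ge 0$ there is a constant $C_k$, depending only on $k$, such that the following holds for every $d\ge 1$. Let $L_1,\dots,L_k$ be (possibly translated) sublattices of $\mathbb{Z}^d$, and suppose that the linear span of the set $S=\mathbb{Z}^d\setminus(L_1\cup\dots\cup L_k)$ is $\mathbb{R}^d$. Then $h(S)\le C_k 2^d$.
   Context: A sublattice of $\mathbb{Z}^d$ is an additive subgroup of $\mathbb{Z}^d$; a (possibly translated) sublattice of $\mathbb{Z}^d$ is a set of the form $v+\Lambda$ with $v\in\mathbb{Z}^d$ and $\Lambda$ a subgroup of $\mathbb{Z}^d$. For $k=0$ no sublattice is removed and $S=\mathbb{Z}^d$. For $S\subseteq\mathbb{R}^d$, the $S$-Helly number $h(S)$ is the smallest positive integer $h$ such that for every $m\in\mathbb{N}$ and all sets $F_1,\dots,F_m$ of the form $F_i=S\cap K_i$ with $K_i\subset\mathbb{R}^d$ convex, the following implication holds: if $F_{i_1}\cap\cdots\cap F_{i_h}\neq\emptyset$ for all $i_1,\dots,i_h\in\{1,\dots,m\}$, then $F_1\cap\cdots\cap F_m\neq\emptyset$. If no such $h$ exists, $h(S):=\infty$. *)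

(* Defs.v *)
From HB Require Import structures.
From mathcomp Require Import all_boot all_order all_algebra.
From mathcomp Require Import mathcomp_extra boolp classical_sets reals.
From mathcomp Require Import constructive_ereal convex.

Set Implicit Arguments.
Unset Strict Implicit.
Unset Printing Implicit Defensive.

Import GRing.Theory.

Local Open Scope classical_set_scope.
Local Open Scope ring_scope.

Definition translated_sublattice (d : nat) (L : set 'rV[int]_d) : Prop :=
  exists (v : 'rV[int]_d) (Lambda : zmodClosed 'rV[int]_d),
    L = [set v + x | x in [set` Lambda]].

Definition embZ (R : realType) (d : nat) (x : 'rV[int]_d) : 'rV[R]_d :=
  map_mx intr x.

Definition linear_span (R : realType) (d : nat) (S : set 'rV[R]_d) :
    set 'rV[R]_d :=
  [set v | exists2 X : seq 'rV[R]_d, [set` X] `<=` S & v \in <<X>>%VS].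

(* For m = 0 the implication holds trivially, the empty intersection
   being the whole space. *)
Definition helly_property (R : realType) (d : nat) (S : set 'rV[R]_d)
    (h : nat) : Prop :=
  forall (m : nat) (F : 'I_m -> set 'rV[R]_d),
    (forall i, exists2 K : set 'rV[R]_d, convex_set K & F i = S `&` K) ->
    (forall i : 'I_h -> 'I_m, \bigcap_(j in [set: 'I_h]) F (i j) !=set0) ->
    \bigcap_(i in [set: 'I_m]) F i !=set0.

(* The least positive integer h with the Helly property, as an extended real;
   +oo if there is none. *)
Definition helly_number (R : realType) (d : nat) (S : set 'rV[R]_d) : \bar R :=
  match pselect (exists h : nat, (0 < h)%N && `[< helly_property S h >]) with
  | left ex_h => ((ex_minn ex_h)%:R)%:E
  | right _ => +oo%E
  end.

(* Main.v *)
Require Import Defs.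
From HB Require Import structures.
From mathcomp Require Import all_boot all_order all_algebra.
From mathcomp Require Import mathcomp_extra boolp classical_sets reals.
From mathcomp Require Import constructive_ereal convex.
From mathcomp Require Import interval_inference zify ring lra.

Import GRing.Theory.

Local Open Scope classical_set_scope.
Local Open Scope ring_scope.

Import Order.TTheory Num.Theory.

Set Implicit Arguments.
Unset Strict Implicit.

(** Suppose that the Helly property fails for h.  A minimal subfamily with empty
    intersection then has more than h members, and each member j can be dropped to
    leave a common point in S.  All these points lie in a bounded box, so the
    problem takes place on the finite set T of points of S in that box.  On T,
    enlarge the traces of the convex sets as long as the family stays critical
    (empty intersection, but nonempty as soon as one member is dropped).  In a
    maximal critical family (A_i) every A_i can be enlarged by a single point
    p_i to the trace of a convex set, because traces of convex sets satisfy the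
    anti-exchange axiom, and maximality puts p_i into all the other A_j.  Hence
    each A_i with p_i added contains all the p_j and their midpoints.  A
    midpoint of p_i and p_j that belongs to T would then lie in every A_l,
    which is impossible: this is [critical_family_points].  So more than h
    points of S have been found no two of which have their midpoint in S
    ([helly_property_of_midpoint_free]).

    Such a set cannot be large.  There are 2^d parity classes, and two points of
    the same class have an integral midpoint, which must lie in one of
    L_1, ..., L_k; this colours the pairs inside a class with k colours.  If a
    class has more than [triangle_bound k] points, there are x, y, w in it whose
    three midpoints lie in the same coset L_c.  Then
      x = (x + y)/2 + (x + w)/2 - (y + w)/2
    lies in L_c as well, although x is in S.  Thus [triangle_bound k] serves as
    the constant C_k ([card_midpoints_in_lattices]). *)

(** * Convex sets and finite traces of them *)

Lemma convex_set_comb (R : realFieldType) (V : lmodType R) (K : set V)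
    (a b : V) (s t : R) :
  convex_set K -> 0 <= s -> 0 <= t -> s + t = 1 ->
  (s != 0 -> K a) -> (t != 0 -> K b) -> K (s *: a + t *: b).
Proof.
move=> cK s0 t0 st1 Ka Kb.
have [s_eq0|sN0] := eqVneq s 0.
  have t1 : t = 1 by rewrite -st1 s_eq0 add0r.
  by rewrite s_eq0 scale0r add0r t1 scale1r; apply: Kb; rewrite t1 oner_eq0.
have [t_eq0|tN0] := eqVneq t 0.
  have s1 : s = 1 by rewrite -st1 t_eq0 addr0.
  by rewrite t_eq0 scale0r addr0 s1 scale1r; exact: Ka.
have s_le1 : s <= 1 by lra.
have := cK a b (Itv01 s0 s_le1) (mem_set (Ka sN0)) (mem_set (Kb tN0)).
have -> : t = 1 - s by lra.
by move/set_mem.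
Qed.

Lemma convex_set_intro (R : realFieldType) (V : lmodType R) (K : set V) :
  (forall (a b : V) (s t : R), 0 <= s -> 0 <= t -> s + t = 1 ->
     K a -> K b -> K (s *: a + t *: b)) ->
  convex_set K.
Proof.
move=> cK a b l /set_mem Ka /set_mem Kb; apply/mem_set.
have l0 : 0 <= l%:num by [].
have l1 : l%:num <= 1 by [].
have comb := cK a b l%:num (1 - l%:num); apply: comb => //.
by rewrite addrC subrK.
Qed.

(** The convex hull of K and x when K is convex.  The guard on K a lets s = 0
    yield the apex x itself even when K is empty. *)
Definition convex_join (R : realFieldType) (V : lmodType R) (K : set V)
    (x : V) : set V :=
  [set z | exists (a : V) (s t : R),
     [/\ 0 <= s, 0 <= t, s + t = 1, (s != 0 -> K a)
       & z = s *: a + t *: x]].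

Section ConvexJoin.
Context (R : realFieldType) (V : lmodType R) (K : set V).
Hypothesis cK : convex_set K.

Lemma sub_convex_join (x : V) : K `<=` convex_join K x.
Proof.
by move=> a Ka; exists a, 1, 0; split; rewrite ?addr0// scale1r scale0r addr0.
Qed.

Lemma convex_join_apex (x : V) : convex_join K x x.
Proof.
exists x, 0, 1; split; rewrite ?add0r ?eqxx//.
by rewrite scale1r scale0r add0r.
Qed.

Lemma convex_join_convex (x : V) : convex_set (convex_join K x).
Proof.
apply: convex_set_intro => _ _ u v u0 v0 uv1 [a [s [t [s0 t0 st1 Ka ->]]]]
  [b [s' [t' [s'0 t'0 st'1 Kb ->]]]].
have us0 : 0 <= u * s by exact: mulr_ge0.
have vs0 : 0 <= v * s' by exact: mulr_ge0.
have xE : u * t + v * t' = 1 - (u * s + v * s').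
  rewrite -uv1 -[X in X + v - _]mulr1 -[X in _ + X - _]mulr1 -{1}st1 -st'1.
  by ring.
have ut0 : 0 <= u * t + v * t' by rewrite addr_ge0 ?mulr_ge0.
have combE : u *: (s *: a + t *: x) + v *: (s' *: b + t' *: x) =
    ((u * s) *: a + (v * s') *: b) + (u * t + v * t') *: x.
  by rewrite !scalerDr !scalerA scalerDl addrACA.
(* With total weight zero on K the combination is the apex; otherwise the
   weights on a and b are renormalised by w to give one point of K. *)
have [w0|wN0] := eqVneq (u * s + v * s') 0.
  have us_eq0 : u * s = 0 by lra.
  have vs_eq0 : v * s' = 0 by lra.
  exists x, 0, 1; split; rewrite ?add0r ?eqxx// combE us_eq0 vs_eq0.
  by rewrite xE w0 subr0 !scale0r !add0r.
set w := u * s + v * s' in xE wN0 *.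
have w_ge0 : 0 <= w by exact: addr_ge0.
exists ((u * s / w) *: a + (v * s' / w) *: b), w, (1 - w); split=> //.
- by rewrite -xE.
- by rewrite addrC subrK.
- move=> _; apply: convex_set_comb; rewrite ?divr_ge0//.
  + by rewrite -mulrDl divff.
  + by rewrite !mulf_eq0 !negb_or => /andP[/andP[_ /Ka]].
  + by rewrite !mulf_eq0 !negb_or => /andP[/andP[_ /Kb]].
- rewrite combE xE; congr (_ + _).
  by rewrite scalerDr !scalerA; congr (_ *: _ + _ *: _); rewrite [RHS]mulrC divfK.
Qed.

(** Anti-exchange: if y = s a + t x and x = s' b + t' y, substituting the second
    equation into the first leaves (1 - t t') y as a nonnegative combination of
    a and b, of total weight 1 - t t'; so y is in K unless t = t' = 1, and then
    y = x. *)
Lemma convex_join_antiexchange (x y : V) :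
  convex_join K x y -> convex_join K y x -> x <> y -> K y.
Proof.
move=> [a [s [t [s0 t0 st1 Ka yE]]]] [b [s' [t' [s'0 t'0 st'1 Kb xE]]]] xy.
have [D0|DN0] := eqVneq (1 - t * t') 0.
  have t1 : t = 1 by nra.
  have s_eq0 : s = 0 by lra.
  by case: xy; rewrite yE t1 s_eq0 scale0r add0r scale1r.
have D_ge0 : 0 <= 1 - t * t' by nra.
have yE' : (1 - t * t') *: y = s *: a + (t * s') *: b.
  rewrite scalerBl scale1r {1}yE [in X in _ + X - _]xE scalerDr !scalerA.
  by rewrite addrA addrK.
have -> : y = (s / (1 - t * t')) *: a + (t * s' / (1 - t * t')) *: b.
  rewrite -[LHS](scalerK DN0) yE' scalerDr !scalerA.
  by rewrite ![_^-1 * _]mulrC.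
apply: convex_set_comb; rewrite ?divr_ge0 ?mulr_ge0//.
- rewrite -mulrDl -[RHS](divff DN0); congr (_ / _).
  have -> : s = 1 - t by lra.
  have -> : s' = 1 - t' by lra.
  by ring.
- by rewrite mulf_eq0 negb_or => /andP[/Ka].
- by rewrite !mulf_eq0 !negb_or => /andP[/andP[_ /Kb]].
Qed.

End ConvexJoin.

Definition convex_trace (R : realFieldType) (V : lmodType R) (T : finType)
    (pt : T -> V) (A : {set T}) : Prop :=
  exists2 K : set V, convex_set K & forall t, t \in A <-> K (pt t).

Section ConvexTrace.
Context (R : realFieldType) (V : lmodType R) (T : finType) (pt : T -> V).
Hypothesis pt_inj : injective pt.

Lemma convex_traceT : convex_trace pt [set: T]%SET.
Proof.
exists setT; first by apply: convex_set_intro.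
by move=> t; rewrite finset.in_setT.
Qed.

Lemma convex_traceI (A : {set T}) (K : set V) :
  convex_trace pt A -> convex_set K ->
  convex_trace pt (A :&: [set t | `[< K (pt t) >]])%SET.
Proof.
move=> [KA cKA AE] cK; exists (KA `&` K); last first.
  move=> t; rewrite finset.in_setI finset.inE; split.
    by move=> /andP[/AE ? /asboolP].
  by move=> [/AE -> ?]; apply/asboolP.
apply: convex_set_intro => a b s t s0 t0 st1 [KAa Ka] [KAb Kb].
by split; apply: convex_set_comb.
Qed.

(** A minimal trace B strictly above A is obtained by adding one point.  For
    z and y in B outside A, the part of B in the join of K and z is again a
    trace strictly above A, hence is B; so y is in the join of K and z, and
    likewise with z and y exchanged, whence y = z by anti-exchange. *)
Lemma convex_trace_add_point (A : {set T}) :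
  convex_trace pt A -> A != [set: T]%SET ->
  exists2 p, p \notin A & convex_trace pt (p |: A).
Proof.
move=> [K cK AE] AN.
pose P (B : {set T}) := (A \proper B) && `[< convex_trace pt B >].
have PT : P [set: T]%SET.
  by rewrite /P finset.properT AN; apply/asboolP; exact: convex_traceT.
case: (arg_minnP (fun B : {set T} => #|B|) PT) => B /andP[AB /asboolP cB] Bmin.
have [sAB [x xB xA]] := properP AB.
have joinB z y : z \in B -> z \notin A -> y \in B ->
    convex_join K (pt z) (pt y).
  move=> zB zA yB.
  set B' := (B :&: [set t | `[< convex_join K (pt z) (pt t) >]])%SET.
  have BB' : B' = B.
    apply/eqP; rewrite eqEcard finset.subsetIl; apply: Bmin; apply/andP; split.
      apply/properP; split; last first.
        exists z => //; rewrite finset.in_setI zB finset.inE; apply/asboolP.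
        exact: convex_join_apex.
      apply/fintype.subsetP => t tA.
      rewrite finset.in_setI (fintype.subsetP sAB)//=.
      by rewrite finset.inE; apply/asboolP/sub_convex_join/AE.
    by apply/asboolP/convex_traceI => //; exact: convex_join_convex.
  by move: yB; rewrite -BB' finset.in_setI finset.inE => /andP[_ /asboolP].
exists x => //; suff -> : x |: A = B by [].
apply/eqP; rewrite finset.eqEsubset; apply/andP; split.
  by rewrite finset.subUset finset.sub1set xB.
apply/fintype.subsetP => y yB; rewrite finset.in_setU1.
have [//|yx] := eqVneq y x; apply/orP; right.
apply: contraT => yA; move: (yA); apply: contraNT => _.
apply/AE; apply: (convex_join_antiexchange cK (joinB _ _ xB xA yB)).
  exact: joinB.
by move=> /pt_inj xy; rewrite xy eqxx in yx.
Qed.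

(** * Critical families *)

(** Passing to a family A of maximal total size makes each member one point
    short of a larger trace: the point p_i completing A_i cannot give another
    critical family, so p_i is in every other A_j.  As p_i is not in A_i, the
    p_i are distinct, and a midpoint of two of them in the ground set would be in every A_l. *)
Lemma critical_family_points (I : finType) (A0 : I -> {set T}) :
  (forall i, convex_trace pt (A0 i)) ->
  (forall j, exists t, forall i, i != j -> t \in A0 i) ->
  ~ (exists t, forall i, t \in A0 i) ->
  exists2 p : I -> T, injective p &
    forall i j t, i != j -> pt t + pt t = pt (p i) + pt (p j) -> False.
Proof.
move=> cA0 critA0 emptyA0.
pose critical (A : {ffun I -> {set T}}) : Prop :=
  [/\ forall i, convex_trace pt (A i),
      forall j, exists t, forall i, i != j -> t \in A i &
      ~ exists t, forall i, t \in A i].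
pose P (A : {ffun I -> {set T}}) := `[< critical A >].
have P0 : P [ffun i => A0 i].
  apply/asboolP; split.
  - by move=> i; rewrite ffunE.
  - by move=> j; have [t tP] := critA0 j; exists t => i /tP; rewrite ffunE.
  - by move=> [t tP]; apply: emptyA0; exists t => i; have := tP i; rewrite ffunE.
case: (arg_maxnP (fun A : {ffun I -> {set T}} => \sum_i #|A i|)%N P0).
move=> A /asboolP[cA critA emptyA] Amax.
have /boolp.choice[p pP] : forall i, exists p, [/\ p \notin A i,
    convex_trace pt (p |: A i) & forall j, j != i -> p \in A j].
  move=> i.
  have AiN : A i != [set: T]%SET.
    apply/negP => /eqP AiT; have [t tP] := critA i; apply: emptyA.
    exists t => j; have [->|/tP//] := eqVneq j i.
    by rewrite AiT finset.in_setT.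
  have [p pA cp] := convex_trace_add_point (cA i) AiN.
  exists p; split => //.
  pose A' := [ffun j => if j == i then p |: A i else A j].
  have sAA' j : A j \subset A' j.
    by rewrite ffunE; case: eqP => // ->; exact: finset.subsetUr.
  have : ~ critical A'.
    move=> critA'; have /asboolP/Amax := critA'; rewrite /geq /=.
    rewrite leqNgt => /negP; apply.
    rewrite (bigD1 i)//= [ltnRHS](bigD1 i)//= -addSn; apply: leq_add.
      by rewrite ffunE eqxx cardsU1 pA.
    by apply: leq_sum => j _; exact: subset_leq_card.
  have [[t tP] _|NA' []] := pselect (exists t, forall j, t \in A' j).
    have tA j : j != i -> t \in A j.
      by move=> ji; have := tP j; rewrite ffunE (negPf ji).
    have tAi : t \notin A i.
      apply/negP => tAi; apply: emptyA; exists t => j.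
      by have [->//|/tA] := eqVneq j i.
    by have := tP i; rewrite ffunE eqxx finset.in_setU1 (negPf tAi) orbF => /eqP <-.
  split => //.
  - by move=> j; rewrite ffunE; case: eqP.
  - move=> j; have [t tP] := critA j; exists t => l /tP.
    exact: (fintype.subsetP (sAA' l)).
have p_inj : injective p.
  move=> i j pij; apply/eqP; apply: contraT => ij.
  have [pi _ _] := pP i; have [_ _ pj] := pP j.
  by move: pi; rewrite pij pj.
exists p => // i j t ij mid.
have ptE : pt t = 2^-1 *: pt (p i) + 2^-1 *: pt (p j).
  rewrite -scalerDr -mid -[pt t in RHS]scale1r -scalerDl scalerA.
  by rewrite [X in X *: _](_ : _ = 1) ?scale1r//; lra.
(* Both p_i and p_j are in p_l |: A_l for every l, hence so is t; it remains to
   see that t is in A_l itself. *)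
have mid_mem B : convex_trace pt B -> p i \in B -> p j \in B -> t \in B.
  move=> [K cK KE] piB pjB; apply/KE; rewrite ptE.
  apply: convex_set_comb; rewrite ?invr_ge0 ?ler0n//; first by lra.
  - by move=> _; apply/KE.
  - by move=> _; apply/KE.
have p_mem q l : p q \in p l |: A l.
  rewrite finset.in_setU1; have [->|ql] := eqVneq q l; first by rewrite eqxx.
  by have [_ _ ->] := pP q; rewrite ?orbT// eq_sym.
have tNi : t != p i.
  apply: contraNneq ij => tpi; move: mid; rewrite tpi.
  by move/addrI/pt_inj/p_inj => ->.
have tNj : t != p j.
  apply: contraNneq ij => tpj; move: mid; rewrite tpj.
  by move/addIr/pt_inj/p_inj => ->.
apply: emptyA; exists t => l.
have [_ cpA _] := pP l.
have [li|li] := eqVneq l i.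
  have := mid_mem _ cpA (p_mem _ _) (p_mem _ _).
  by rewrite finset.in_setU1 {1}li (negPf tNi).
have [lj|lj] := eqVneq l j.
  have := mid_mem _ cpA (p_mem _ _) (p_mem _ _).
  by rewrite finset.in_setU1 {1}lj (negPf tNj).
have [_ _ piA] := pP i; have [_ _ pjA] := pP j.
by apply: mid_mem => //; [exact: piA|exact: pjA].
Qed.

End ConvexTrace.

(** * Ramsey bound for monochromatic triangles *)

(** Any [triangle_bound k].+1 vertices contain a monochromatic triangle when
    their pairs are coloured with k colours; the recursion comes from choosing
    one vertex and the most frequent of the k colours among its edges. *)
Fixpoint triangle_bound (k : nat) : nat :=
  if k is k'.+1 then (k * triangle_bound k').+1 else 1%N.

Lemma triangle_bound_gt0 (k : nat) : (0 < triangle_bound k)%N.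
Proof. by case: k. Qed.

(** Some colour c joins a vertex v to more than [triangle_bound n] others.  Either
    two of those are joined by c, which closes a triangle at v, or the colour c
    does not occur among them and induction applies. *)
Lemma monochromatic_triangle (V C : finType) (E : C -> rel V)
    (D : {set C}) (A : {set V}) :
  (forall x y, x \in A -> y \in A -> x != y ->
     exists2 c, c \in D & E c x y) ->
  (triangle_bound #|D| < #|A|)%N ->
  exists c x y z, [/\ uniq [:: x; y; z], E c x y, E c x z & E c y z].
Proof.
move: {2}#|D| (erefl #|D|) => n; elim: n D A => [|n IH] D A Dn cover.
  rewrite Dn => /card_gt1P[x [y [xA yA xy]]].
  have [c] := cover x y xA yA xy.
  by rewrite (cards0_eq Dn) finset.inE.
rewrite Dn /= => Abig.
have /card_gt0P[v vA] : (0 < #|A|)%N by exact: leq_trans Abig.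
pose N c := [set u in A :\ v | E c v u]%SET.
have [c cD Nc] : exists2 c, c \in D & (triangle_bound n < #|N c|)%N.
  apply/exists_inP; apply: contraT; rewrite negb_exists_in => /forall_inP small.
  move: Abig; rewrite (cardsD1 v) vA add1n ltnS ltnNge => /negP[].
  rewrite -Dn -sum_nat_const.
  have sub : A :\ v \subset (\bigcup_(c in D) N c)%SET.
    apply/fintype.subsetP => u uA.
    move: (uA); rewrite finset.in_setD1 => /andP[uv u'A].
    have [|c cD Evu] := cover v u vA u'A; first by rewrite eq_sym.
    by apply/finset.bigcupP; exists c => //; rewrite finset.inE uA.
  apply: leq_trans (subset_leq_card sub) _.
  elim/big_rec2: _ => [|c m B cD leB]; first by rewrite cards0.
  apply: leq_trans (leq_card_setU _ _).1 (leq_add _ leB).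
  by rewrite leqNgt; exact: small.
have inN u : u \in N c -> [/\ u != v, u \in A & E c v u].
  by rewrite finset.inE finset.in_setD1 => /andP[/andP[-> ->] ->].
have [/existsP[x /existsP[y /and4P[xN yN xy Exy]]]|noE] :=
  boolP [exists x, exists y, [&& x \in N c, y \in N c, x != y & E c x y]].
  have [xv _ Evx] := inN x xN; have [yv _ Evy] := inN y yN.
  exists c, v, x, y; split => //=.
  by rewrite !inE xy negb_or eq_sym xv eq_sym yv.
apply: (IH (D :\ c) (N c)).
- by apply/eqP; move: Dn; rewrite (cardsD1 c) cD add1n => -[->].
- move=> x y xN yN xy; have [_ xA _] := inN x xN; have [_ yA _] := inN y yN.
  have [c' c'D Exy] := cover x y xA yA xy; exists c' => //.
  rewrite finset.in_setD1 c'D andbT; apply: contraNneq noE => c'c.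
  rewrite c'c in Exy.
  by apply/existsP; exists x; apply/existsP; exists y; apply/and4P.
- by move: Dn; rewrite (cardsD1 c) cD add1n => -[->].
Qed.

Lemma pigeonhole_fiber (I P : finType) (f : I -> P) (n : nat) :
  (n * #|P| < #|I|)%N -> exists y, (n < #|[set x | f x == y]%SET|)%N.
Proof.
move=> big; apply/existsP; apply: contraT; rewrite negb_exists => /forallP small.
move: big; rewrite ltnNge => /negP[].
rewrite mulnC -sum_nat_const -sum1_card (partition_big f predT)//=.
apply: leq_sum => y _; have := small y; rewrite -leqNgt; apply: leq_trans.
rewrite sum1_card; apply/subset_leq_card/fintype.subsetP => x.
by rewrite finset.inE.
Qed.

(** * Midpoints of integer points *)

Lemma translated_sublattice_addB (d : nat) (L : set 'rV[int]_d)
    (x y z : 'rV[int]_d) :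
  translated_sublattice L -> L x -> L y -> L z -> L (x + y - z).
Proof.
move=> [v [G ->]] [x' /= Gx <-] [y' /= Gy <-] [z' /= Gz <-].
exists (x' + y' - z'); first by rewrite /= rpredB// rpredD.
by apply/rowP => i; rewrite !mxE; ring.
Qed.

Definition parity (d : nat) (z : 'rV[int]_d) : {ffun 'I_d -> bool} :=
  [ffun i => odd `|z 0%R i|].

Lemma parity_midpoint (d : nat) (x y : 'rV[int]_d) :
  parity x = parity y -> exists m, m + m = x + y.
Proof.
move=> /ffunP xy; exists (\row_i ((x 0%R i + y 0%R i) %/ 2)%Z).
apply/rowP => i; rewrite !mxE; have := xy i; rewrite !ffunE.
by move: (x 0 i) (y 0 i) => a b; lia.
Qed.

(** Within a parity class of more than [triangle_bound k] points, three would
    have their midpoints p, r, s in the same L_c, and p + r - s is one of the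
    three points. *)
Lemma card_midpoints_in_lattices (d k : nat) (L : 'I_k -> set 'rV[int]_d)
    (I : finType) (z : I -> 'rV[int]_d) :
  (forall c, translated_sublattice (L c)) ->
  (forall c i, ~ L c (z i)) ->
  (forall i j m, i != j -> m + m = z i + z j -> exists c, L c m) ->
  (#|I| <= triangle_bound k * 2 ^ d)%N.
Proof.
move=> latL zL midL; rewrite leqNgt; apply/negP => big.
have [|q] := @pigeonhole_fiber I _ (fun i => parity (z i)) (triangle_bound k).
  by rewrite card_ffun card_bool card_ord.
set A := [set i | _]%SET => Abig.
pose E (c : 'I_k) i j := `[< exists2 m, m + m = z i + z j & L c m >].
have [| |c [x [y [w [_ /asboolP[p pE Lp] /asboolP[r rE Lr] /asboolP[s sE Ls]]]]]] :=
    @monochromatic_triangle I 'I_k E [set: 'I_k]%SET A.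
- move=> i j; rewrite !finset.inE => /eqP iq /eqP jq ij.
  have [m mE] := parity_midpoint (etrans iq (esym jq)).
  have [c Lm] := midL i j m ij mE.
  by exists c; rewrite ?finset.in_setT//; apply/asboolP; exists m.
- by rewrite cardsT card_ord.
apply: (zL c x); have -> : z x = p + r - s; last exact: translated_sublattice_addB.
apply/rowP => i; move/rowP: pE => /(_ i); move/rowP: rE => /(_ i).
move/rowP: sE => /(_ i); rewrite !mxE.
by move: (z x 0 i) (z y 0 i) (z w 0 i) (p 0 i) (r 0 i) (s 0 i) => ? ? ? ? ? ?; lia.
Qed.

(** * From midpoints to the Helly number *)

Lemma embZ_inj (R : realType) (d : nat) : injective (@embZ R d).
Proof.
move=> x y /rowP xy; apply/rowP => i.
by have := xy i; rewrite !mxE => /eqP; rewrite eqr_int => /eqP.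
Qed.

Lemma embZD (R : realType) (d : nat) (x y : 'rV[int]_d) :
  embZ R (x + y) = embZ R x + embZ R y.
Proof. by apply/rowP => i; rewrite !mxE intrD. Qed.

Section Box.
Context (d N : nat).

(** Indexing the cube of integer points with coordinates in [-N, N] by a
    finite type. *)
Definition box_point (t : 'rV['I_(N + N).+1]_d) : 'rV[int]_d :=
  \row_i ((t 0 i : nat)%:Z - N%:Z).

Lemma box_point_inj : injective box_point.
Proof.
move=> s t /rowP st; apply/rowP => i; apply/val_inj => /=.
have := st i; rewrite !mxE.
by move: (nat_of_ord (s 0 i)) (nat_of_ord (t 0 i)) => a b; lia.
Qed.

Lemma box_point_bound (t : 'rV['I_(N + N).+1]_d) (i : 'I_d) :
  (`|box_point t 0%R i| <= N)%N.
Proof. by rewrite mxE; have := ltn_ord (t 0 i); lia. Qed.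

Lemma box_point_surj (z : 'rV[int]_d) :
  (forall i, (`|z 0%R i| <= N)%N) -> exists t, box_point t = z.
Proof.
move=> zN; exists (\row_i inord (absz (z 0 i + N%:Z))).
apply/rowP => i; rewrite !mxE inordK; have := zN i;
  by move: (z 0 i) => a; lia.
Qed.

End Box.

(** The finite ground set must contain the witnesses z_j of criticality and be
    stable under midpoints that belong to Z; the points of Z in a cube do both,
    the cube being convex. *)
Lemma helly_property_of_midpoint_free (R : realType) (d h : nat)
    (Z : set 'rV[int]_d) :
  (0 < h)%N ->
  (forall (I : finType) (z : I -> 'rV[int]_d),
     (forall i, Z (z i)) ->
     (forall i j m, i != j -> m + m = z i + z j -> ~ Z m) -> (#|I| <= h)%N) ->
  helly_property [set embZ R x | x in Z] h.
Proof.
move=> h0 midh m F Fconv Fh; apply: contrapT => Fempty.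
pose P (J : {set 'I_m}) := `[< ~ exists x, forall i, i \in J -> F i x >].
have PT : P [set: 'I_m]%SET.
  by apply/asboolP => -[x xF]; apply: Fempty; exists x => i _; exact: xF.
case: (arg_minnP (fun J : {set 'I_m} => #|J|) PT) => J /asboolP PJ Jmin.
have hJ : (h < #|J|)%N.
  rewrite ltnNge; apply/negP => Jh; apply: PJ.
  have [->|/finset.set0Pn[j0 j0J]] := eqVneq J finset.set0.
    by exists 0 => i; rewrite finset.inE.
  have [x xF] := Fh (fun i => nth j0 (enum J) i); exists x => j jJ.
  have jh : (index j (enum J) < h)%N.
    by apply: leq_trans Jh; rewrite cardE index_mem mem_enum.
  by have := xF (Ordinal jh) I; rewrite /= nth_index// mem_enum.
(* As J has at least two members, each witness below belongs to some F i, which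
   is what places it in the image of Z. *)
have others (j : 'I_m) : exists i, i \in J /\ i != j.
  have /card_gt0P[i] : (0 < #|J :\ j|)%N.
    have := leq_trans h0 (ltnW hJ); move: hJ; rewrite (cardsD1 j J).
    by case: (j \in J) => /=; move: #|_| => c; lia.
  by rewrite finset.in_setD1 => /andP[ij iJ]; exists i.
have /boolp.choice[z zP] : forall j, exists z, j \in J ->
    Z z /\ (forall i, i \in J -> i != j -> F i (embZ R z)).
  move=> j; have [jJ|_] := boolP (j \in J); last by exists 0.
  have /contrapT[x xF] : ~ ~ exists x, forall i, i \in J :\ j -> F i x.
    by move=> /asboolP/Jmin; rewrite (cardsD1 j J) jJ ltnn.
  have xFi i : i \in J -> i != j -> F i x.
    by move=> iJ ij; apply: xF; rewrite finset.in_setD1 ij.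
  have [i [iJ ij]] := others j.
  have [K _ FK] := Fconv i.
  have := xFi i iJ ij; rewrite FK => -[[z Zz zx] _].
  by exists z => _; split => // l lJ lj; rewrite zx; exact: xFi.
pose N := (\max_(j < m) \max_(c < d) `|z j 0%R c|)%N.
have zN j c : (`|z j 0%R c| <= N)%N.
  exact: leq_trans (leq_bigmax c) (leq_bigmax j).
pose T := {t : 'rV['I_(N + N).+1]_d | `[< Z (box_point t) >]}.
pose pt (t : T) := embZ R (box_point (val t)).
have ptZ (t : T) : Z (box_point (val t)) by apply/asboolP; exact: (valP t).
have pt_inj : injective pt.
  by move=> s t /embZ_inj/box_point_inj/val_inj.
have pt_surj w : Z w -> (forall c, (`|w 0%R c| <= N)%N) ->
    exists t : T, box_point (val t) = w.
  move=> Zw /box_point_surj[t tw].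
  have tP : `[< Z (box_point t) >] by apply/asboolP; rewrite tw.
  by exists (exist _ t tP).
pose I := {i : 'I_m | i \in J}.
pose A (i : I) := [set t : T | `[< F (val i) (pt t) >]]%SET.
have [i||[t tA]|p p_inj pmid] := @critical_family_points R _ T pt pt_inj I A.
- have [K cK FK] := Fconv (val i); exists K => // t.
  rewrite finset.inE FK; split; first by move=> /asboolP[].
  by move=> Kt; apply/asboolP; split => //; exists (box_point (val t)).
- move=> j; have [Zj Fj] := zP _ (valP j).
  have [t tz] := pt_surj _ Zj (zN (val j)).
  exists t => i ij; rewrite finset.inE; apply/asboolP; rewrite /pt tz.
  by apply: Fj => //; exact: (valP i).
- apply: PJ; exists (pt t) => i iJ.
  by have := tA (exist _ i iJ); rewrite finset.inE => /asboolP.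
have := midh I (fun i => box_point (val (p i))) (fun i => ptZ (p i)).
rewrite card_sig leqNgt => /(_ _)/negP[]; last first.
  by rewrite (eq_card (B := J)).
move=> i j w ij wE Zw; have [|t tw] := pt_surj w Zw.
  move=> c; move/rowP: wE => /(_ c); rewrite !mxE.
  have := box_point_bound (val (p i)) c; have := box_point_bound (val (p j)) c.
  rewrite !mxE.
  by move: (nat_of_ord _) (nat_of_ord _) (w 0 c) => a b e; lia.
by apply: (pmid i j t ij); rewrite /pt tw -!embZD wE.
Qed.

Lemma helly_number_le (R : realType) (d h : nat) (S : set 'rV[R]_d) :
  (0 < h)%N -> helly_property S h -> (helly_number S <= (h%:R)%:E)%E.
Proof.
move=> h0 Sh; rewrite /helly_number; case: pselect => [ex_h|[]]; last first.
  by exists h; rewrite h0; apply/asboolP.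
case: ex_minnP => n _ nmin; rewrite lee_fin ler_nat.
by apply: nmin; rewrite h0; apply/asboolP.
Qed.

Theorem theorem1p4 (R : realType) (k : nat) :
  exists C : R,
    forall (d : nat) (L : 'I_k -> set 'rV[int]_d),
      (1 <= d)%N ->
      (forall i : 'I_k, translated_sublattice (L i)) ->
      let S := [set embZ R x | x in
                  [set: 'rV[int]_d] `\` \bigcup_(i in [set: 'I_k]) L i] in
      linear_span S = [set: 'rV[R]_d] ->
      (helly_number S <= (C * 2 ^+ d)%:E)%E.
Proof.
exists (triangle_bound k)%:R => d L _ latL S _.
have h0 : (0 < triangle_bound k * 2 ^ d)%N.
  by rewrite muln_gt0 triangle_bound_gt0 expn_gt0.
rewrite -natrX -natrM; apply: helly_number_le => //.
apply: helly_property_of_midpoint_free => // I z zS mid.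
apply: (card_midpoints_in_lattices latL (z := z)).
- by move=> c i Lz; have [_] := zS i; apply; exists c.
- move=> i j m ij mE; apply: contrapT => noL; apply: (mid i j m ij mE).
  by split => // -[c _ Lm]; apply: noL; exists c.
Qed.
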